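(* Let $L=(L,\wedge,\vee,1,0)$ be a complete lattice and $X\subseteq L\setminus\{1\}$ a finite subset such that $L$ is an $X$-top lattice, and equip $X$ with its Zariski-like topology. (1) If $X$ is a forest that is a (nonempty, finite) combination of disjoint trees $\mathcal T_{n_i}$ with $n_i\ge2$ for each $i$, then $X$ is $T_{\frac34}$ but not $T_1$. (2) If $X$ is $T_{\frac34}$, then $K.\dim(X)\le1$ and $X$ does not contain a disjoint $\mathcal V_n$ (for any $n\ge1$).
   Context: For a complete lattice $L=(L,\wedge,\vee,1,0)$, $X\subseteq L\setminus\{1\}$ and $a\in L$, put $V(a)=\{x\in X: a\le x\}$ and $D(a)=X\setminus V(a)$. $L$ is an $X$-top lattice iff the family $\{V(a):a\in L\}$ is closed under finite unions (it always contains $X=V(0)$, $\emptyset=V(1)$ and is closed under arbitrary intersections); then the sets $D(a)$, $a\in L$, are the open sets of a topology on $X$, called the Zariski-like topology. $X$ is a poset with the order of $L$. The height of $x\in X$ is $ht(x)=\sup\{n\ge 0: \text{there are } x_0<\dots<x_n=x \text{ in } X\}$, and $K.\dim(X)=\sup\{ht(x):x\in X\}$ (suprema in $\{0,1,2,\dots,\infty\}$). $\mathcal T_n$ denotes the poset consisting of one maximal element lying over $n$ pairwise incomparable minimal elements; $\mathcal V_n$ denotes the poset consisting of one minimal element lying under $n$ pairwise incomparable maximal elements ($\mathcal T_1=\mathcal V_1$ is a two-element chain). ''Disjoint'' means separate as components of the poset $X$: in (1), $X$ is the disjoint union of subsets order-isomorphic to the $\mathcal T_{n_i}$ with elements of different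 pieces incomparable; in (2), containing a disjoint $\mathcal V_n$ means that there is a subset $Y\subseteq X$ order-isomorphic to $\mathcal V_n$ such that no element of $Y$ is comparable to any element of $X\setminus Y$. A topological space $X$ is $T_{\frac34}$ iff for every $x\in X$, $\{x\}$ is closed or $\{x\}=\mathrm{int}(\overline{\{x\}})$. *)

(* Defs.v *)
From HB Require Import structures.
From mathcomp Require Import all_boot all_order all_algebra.
From mathcomp Require Import boolp classical_sets functions cardinality.
From mathcomp Require Import constructive_ereal.
From mathcomp Require Import topology_structure separation_axioms.
From mathcomp Require Import measurable_structure.

Set Implicit Arguments.
Unset Strict Implicit.
Unset Printing Implicit Defensive.

Import Order.TTheory.

Local Open Scope order_scope.
Local Open Scope classical_set_scope.

Definition complete_lattice d (L : tbLatticeType d) : Prop :=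
  forall A : set L,
    supremums A !=set0 /\ infimums A !=set0.

Section XTop.
Context d (L : tbLatticeType d) (X : set L).

Definition variety (a : L) : set L := [set x | X x /\ a <= x].

Definition covariety (a : L) : set L := X `\` variety a.

Definition Xtop_lattice : Prop := fin_bigcup_closed (range variety).

End XTop.

(* The points of [X]; the proofs are arguments of the type so that the
   Zariski-like topology below can be a canonical instance on it. *)
Definition zariski d (L : tbLatticeType d) (X : set L)
  (cL : complete_lattice L) (X1 : ~ X \top) (tL : Xtop_lattice X) : Type :=
  set_type X.

Section Zariski.
Context d (L : tbLatticeType d) (X : set L).
Hypotheses (cL : complete_lattice L) (X1 : ~ X \top) (tL : Xtop_lattice X).

HB.instance Definition _ := Choice.copy (zariski cL X1 tL) (set_type X).

Definition zariski_open (U : set (zariski cL X1 tL)) : Prop :=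
  exists a : L, U = [set x | covariety X a (val x)].

Let zariski_openE (a : L) (x : set_type X) :
  covariety X a (val x) <-> ~ a <= val x.
Proof.
split=> [[Xx nV] ax|nax]; first by apply: nV; split.
by split=> [|[]//]; exact: set_valP.
Qed.

Lemma zariski_openT : zariski_open setT.
Proof.
exists \top; apply/seteqP; split=> // x _; apply/zariski_openE.
by rewrite le1x => /eqP x1; apply: X1; rewrite -x1; exact: set_valP.
Qed.

Lemma zariski_openI : setI_closed zariski_open.
Proof.
move=> _ _ [a ->] [b ->].
have [_ tU] := (fin_bigcup_closedP (range (variety X))).2 tL.
have [c _ Vc] : range (variety X) (variety X a `|` variety X b).
  by apply: tU; [exists a|exists b].
exists c; apply/seteqP; split=> x /=.
  move=> [[Xx na] [_ nb]]; split=> //; rewrite Vc => -[]//.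
by rewrite /covariety Vc => -[Xx nab]; split; split=> // v; apply: nab;
  [left|right].
Qed.

Lemma zariski_open_bigcup (I : Type) (f : I -> set (zariski cL X1 tL)) :
  (forall i, zariski_open (f i)) -> zariski_open (\bigcup_i f i).
Proof.
move=> fo.
pose A := [set a | exists i, f i = [set x | covariety X a (val x)]].
have [[s [As sA]] _] := cL A.
exists s; apply/seteqP; split=> x /=.
  move=> [i _]; have [a fa] := fo i; rewrite fa => /zariski_openE nax.
  apply/zariski_openE => sx; apply: nax; apply: le_trans sx.
  by apply: As; exists i.
move=> /zariski_openE nsx; apply: contrapT => nU; apply: nsx.
apply: sA => a [i fa]; apply: contrapT => nax; apply: nU.
by exists i => //; rewrite fa; apply/zariski_openE.
Qed.

HB.instance Definition _ := isOpenTopological.Build (zariski cL X1 tL)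
  zariski_openT zariski_openI zariski_open_bigcup.

Lemma zariski_openP (U : set (zariski cL X1 tL)) : open U <-> zariski_open U.
Proof. by []. Qed.

End Zariski.

Definition T34_space (T : topologicalType) : Prop :=
  forall x : T, closed [set x] \/ [set x] = (closure [set x])^°.

Section Height.
Context d (P : porderType d) (X : set P).

Definition chain_to (x : P) (n : nat) : Prop :=
  exists c : 'I_n.+1 -> P,
    [/\ forall i, X (c i), {homo c : i j / (i < j)%N >-> i < j}
      & c ord_max = x].

(* Suprema in {0, 1, 2, ..., oo}: all the sets below consist of nonnegative
   elements of [\bar int], and the supremum of the empty set is set to 0. *)
Definition height (x : P) : \bar int :=
  supremum 0%E [set (n%:Z)%:E | n in chain_to x].

Definition Kdim : \bar int := supremum 0%E (height @` X).

End Height.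

Fact tree_display : Order.disp_t. Proof. by []. Qed.

(* [None] is the root, lying over the [n] leaves [Some i]. *)
Definition treeT (n : nat) : Type := option 'I_n.

Section TreeOrder.
Variable n : nat.

HB.instance Definition _ := Choice.on (treeT n).

Definition treeT_le (x y : treeT n) : bool := (x == y) || (y == None).

Let treeT_le_refl : reflexive treeT_le.
Proof. by move=> x; rewrite /treeT_le eqxx. Qed.

Let treeT_le_anti : antisymmetric treeT_le.
Proof.
move=> x y /andP[/orP[/eqP//|/eqP ->]].
by rewrite /treeT_le => /orP[/eqP ->|/eqP ->].
Qed.

Let treeT_le_trans : transitive treeT_le.
Proof.
move=> y x z /orP[/eqP -> //|/eqP ->]; rewrite /treeT_le.
by move=> /orP[/eqP <-|->]; rewrite ?eqxx orbT.
Qed.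

HB.instance Definition _ := Order.Le_isPOrder.Build tree_display (treeT n)
  treeT_le_refl treeT_le_anti treeT_le_trans.

End TreeOrder.

Definition order_isomorphic d d' (P : porderType d) (L : porderType d')
    (Y : set L) : Prop :=
  exists f : P -> L, set_bij setT Y f /\ {mono f : p q / p <= q}.
Arguments order_isomorphic {d d'} P {L} Y.

Definition is_treeT d (L : porderType d) (n : nat) (Y : set L) : Prop :=
  order_isomorphic (treeT n) Y.

Definition is_treeV d (L : porderType d) (n : nat) (Y : set L) : Prop :=
  order_isomorphic ((treeT n)^d)%type Y.

Definition disjoint_treesT d (L : porderType d) (X : set L) : Prop :=
  exists (k : nat) (n : 'I_k -> nat) (Y : 'I_k -> set L),
    [/\ (0 < k)%N,
        forall i, (2 <= n i)%N /\ is_treeT (n i) (Y i),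
        X = \bigcup_i Y i,
        trivIset setT Y
      & forall i j, i != j -> forall x y, Y i x -> Y j y -> x >< y].

Definition contains_disjoint_treeV d (L : porderType d) (n : nat)
    (X : set L) : Prop :=
  exists Y : set L,
    [/\ Y `<=` X, is_treeV n Y
      & forall x y, Y x -> (X `\` Y) y -> x >< y].

(* Main.v *)
(** Since [X] is finite and [L] is [X]-top, every up-set of [X] is a finite
    union of sets [V(x)], so the Zariski-like topology is the Alexandrov
    topology whose open sets are the down-sets of [X]. A singleton is then
    closed iff its point is maximal, and [x] is the interior of its closure iff
    [x] is minimal and every [y] strictly above [x] is also above some point not
    above [x]. *)
Require Import Defs.
From mathcomp Require Import all_boot all_order all_algebra.
From mathcomp Require Import boolp classical_sets functions cardinality.
From mathcomp Require Import constructive_ereal.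
From mathcomp Require Import topology_structure separation_axioms.

Import Order.TTheory.

Section FiniteXTop.
Set Implicit Arguments.
Unset Strict Implicit.
Local Open Scope order_scope.
Local Open Scope classical_set_scope.

Section Alexandrov.
Context (d : Order.disp_t) (L : tbLatticeType d) (X : set L).
Context (cL : complete_lattice L) (finX : finite_set X) (X1 : ~ X \top).
Context (tL : Xtop_lattice X).
Local Notation Z := (zariski cL X1 tL).

Lemma zariski_open_downset (U : set Z) :
  open U <-> forall x y : Z, val x <= val y -> U y -> U x.
Proof.
split=> [/zariski_openP[a ->] x y xy /= [Xy nVy]|downU].
  split; first exact: set_valP.
  by move=> [Xx ax]; apply: nVy; split=> //; exact: le_trans xy.
pose C : set L := val @` ~` U.
have CX : C `<=` X by move=> _ [x _ <-]; exact: set_valP.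
have [a _ Va] : range (variety X) (\bigcup_(x in C) variety X x).
  by apply: tL => [|x _]; [exact: sub_finite_set finX|exists x].
apply/zariski_openP; exists a; apply/seteqP; split=> x /= => [Ux|[_]].
  split; first exact: set_valP.
  by rewrite Va => -[_ [z nUz <-]] [_ zx]; apply: nUz; exact: downU Ux.
rewrite Va => nCx; apply: contrapT => nUx; apply: nCx.
by exists (val x); [exists x|split=> //; exact: set_valP].
Qed.

Lemma zariski_closed_upset (F : set Z) :
  closed F <-> forall x y : Z, val x <= val y -> F x -> F y.
Proof.
rewrite -openC zariski_open_downset; split=> cF x y xy.
  by move=> Fx; apply: contrapT => /(cF _ _ xy); apply.
by move=> nFy /(cF _ _ xy).
Qed.

(** The principal down-set of [y] is the smallest open neighbourhood of [y], so it alone decides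
    whether [y] is interior. *)
Lemma zariski_interior (A : set Z) :
  A° = [set y | forall z : Z, val z <= val y -> A z].
Proof.
apply/seteqP; split=> y /= => [Ay z zy|Ay].
  apply: interior_subset; move: Ay.
  exact: (zariski_open_downset _).1 (open_interior A) _ _ zy.
rewrite interiorEbigcup; exists [set z : Z | val z <= val y] => //=.
split; last by move=> z; exact: Ay.
by apply/zariski_open_downset => u v uv /= vy; exact: le_trans vy.
Qed.

Lemma zariski_closure1 (x : Z) :
  closure [set x] = [set y | val x <= val y].
Proof.
rewrite -[closure _]setCK -interiorC zariski_interior.
apply/seteqP; split=> y /= => [|xy /(_ x xy)]; last exact.
by apply: contra_notP => nxy z zy /= zx; apply: nxy; rewrite -zx.
Qed.

Lemma accessible_zariski_antichain (x y : L) :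
  accessible_space Z -> X x -> X y -> x <= y -> x = y.
Proof.
move=> T1 Xx Xy xy.
have /zariski_closed_upset := @accessible_closed_set1 _ T1 (SigSub (mem_set Xx) : Z).
move=> /(_ _ (SigSub (mem_set Xy) : Z) _ erefl) /= Xxy.
by have /(congr1 val) := Xxy xy.
Qed.

Lemma closed_zariski1 (x : Z) :
  closed [set x] <-> forall y, X y -> val x <= y -> y = val x.
Proof.
split=> [/zariski_closed_upset cx y Xy xy|xmax].
  have /(_ xy erefl) := cx x (SigSub (mem_set Xy)).
  by move=> /(congr1 val).
apply/zariski_closed_upset => y z yz /= yx; apply: val_inj.
by apply: xmax; [exact: set_valP|rewrite -yx].
Qed.

(** The two conjuncts are the two inclusions: minimality of [x] puts [x] in the interior of its
    up-set, and the second conjunct says that no other point has its whole down-set above [x]. *)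
Lemma eq_interior_closure1 (x : Z) :
  [set x] = (closure [set x])° <->
  (forall y, X y -> y <= val x -> y = val x) /\
  forall y, X y -> (forall z, X z -> z <= y -> val x <= z) -> y = val x.
Proof.
rewrite zariski_closure1 zariski_interior; split=> [/seteqP[sx xs]|[xmin xint]].
  split=> y Xy.
    move=> yx; have /= xy := sx x erefl (SigSub (mem_set Xy)) yx.
    by apply/eqP; rewrite eq_le yx.
  move=> yP; have /(congr1 val) // : (SigSub (mem_set Xy) : Z) = x.
  by apply: xs => z /= zy; apply: yP => //; exact: set_valP.
apply/seteqP; split=> y /=.
  by move=> -> z zx; rewrite (xmin _ (set_valP z) zx).
move=> yP; apply: val_inj; apply: xint; first exact: set_valP.
by move=> z Xz zy; exact: (yP (SigSub (mem_set Xz))).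
Qed.

Lemma T34_zariskiP :
  T34_space Z <->
  forall x, X x ->
    (forall y, X y -> x <= y -> y = x) \/
    ((forall y, X y -> y <= x -> y = x) /\
     forall y, X y -> (forall z, X z -> z <= y -> x <= z) -> y = x).
Proof.
split=> [T34 x Xx|T34 x].
  case: (T34 (SigSub (mem_set Xx) : Z)).
    by move/closed_zariski1; left.
  by move/eq_interior_closure1; right.
case: (T34 _ (set_valP x)) => [xmax|xmin]; [left|right].
  exact/closed_zariski1.
exact/eq_interior_closure1.
Qed.

End Alexandrov.

(** [supremum] returns [x0] when [A] is empty or has no supremum, so the default must be bounded
    too. *)
Lemma supremum_le d (P : porderType d) (x0 b : P) (A : set P) :
  x0 <= b -> (forall x, A x -> x <= b) -> supremum x0 A <= b.
Proof.
move=> x0b Ab; rewrite /supremum; case: ifPn => // _.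
by case: xgetP => [s _ [_ sA]|//]; exact: sA.
Qed.

Lemma Kdim_le1 d (P : porderType d) (X : set P) :
  (forall x y z, X x -> X y -> X z -> x < y -> ~ y < z) -> (Kdim X <= 1)%E.
Proof.
move=> noch; apply: supremum_le => [|_ [x Xx <-]] //.
apply: supremum_le => [|_ [n [c [Xc cmono _]] <-]] //.
(* Lengths 0 and 1 meet the bound outright; a longer chain starts with three elements, which [noch]
   forbids. *)
case: n c Xc cmono => [|[|n]] // c Xc cmono.
by case: (noch _ _ _ (Xc (inord 0)) (Xc (inord 1)) (Xc (inord 2)));
  apply: cmono; rewrite !inordK.
Qed.

Lemma treeT_leE n (p q : treeT n) : (p <= q) = (p == q) || (q == None).
Proof. by []. Qed.

(** Isolates the tree through [x]. Since distinct trees are incomparable, it absorbs every point of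
    [X] comparable to one of its own, so order questions around [x] can be settled inside
    [treeT n]. *)
Lemma disjoint_treesT_split d (L : porderType d) (X : set L) (x : L) :
  disjoint_treesT X -> X x ->
  exists n (Y : set L) (f : treeT n -> L),
    [/\ (2 <= n)%N, set_bij setT Y f, {mono f : p q / p <= q}, Y `<=` X
      & Y x /\ forall y z, Y y -> X z -> y >=< z -> Y z].
Proof.
move=> [k [n [Y [_ nY -> _ Yinc]]]] [i _ Yx].
have [n2 [f [fbij fmono]]] := nY i.
exists (n i), (Y i), f; split=> //; first by move=> y Yy; exists i.
split=> // y z Yy [j _ Yz] yz; have [-> //|ij] := eqVneq i j.
by have := Yinc _ _ ij _ _ Yy Yz; rewrite yz.
Qed.

End FiniteXTop.

Theorem theorem3p20 (d : Order.disp_t) (L : tbLatticeType d) (X : set L)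
    (cL : complete_lattice L) (finX : finite_set X) (X1 : ~ X (\top)%O)
    (tL : Xtop_lattice X) :
  (disjoint_treesT X ->
     T34_space (zariski cL X1 tL) /\ ~ accessible_space (zariski cL X1 tL)) /\
  (T34_space (zariski cL X1 tL) ->
     (Kdim X <= 1)%E /\
     forall n : nat, (1 <= n)%N -> ~ contains_disjoint_treeV n X).
Proof.
split=> [treesX|/(T34_zariskiP cL finX X1 tL) T34].
  split.
    apply/(T34_zariskiP cL finX X1 tL) => x Xx.
    have [n [Y [f [n2 [fY finj fsurj] fmono YX [Yx Ycomp]]]]] :=
      disjoint_treesT_split treesX Xx.
    have [p _ fpx] := fsurj _ Yx; subst x.
    have Yq q : Y (f q) by exact: fY.
    (* The root is maximal in [X], so it falls under the closed case; a leaf falls under the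
       other. *)
    case: p => [a|] in Xx Yx *; [right|left]; last first.
      move=> y Xy xy.
      have [q _ fqy] := fsurj y (Ycomp _ _ Yx Xy (le_comparable xy)).
      subst y; move: xy; rewrite fmono treeT_leE eq_sym orbb => /eqP -> //.
    split=> y Xy yP.
      have [q _ fqy] := fsurj y (Ycomp _ _ Yx Xy (ge_comparable yP)).
      by subst y; move: yP; rewrite fmono treeT_leE orbF => /eqP ->.
    have xy : (f (Some a) <= y)%O by exact: yP.
    have [[b|] _ fqy] := fsurj y (Ycomp _ _ Yx Xy (le_comparable xy)); subst y.
      by move: xy; rewrite fmono treeT_leE orbF => /eqP ->.
    (* Remaining case: [y] is the root. As [n] is at least 2 there is a second leaf [b]; it lies
       below the root but not above [a], contradicting [yP]. *)
    have [b ab] : exists b, a != b.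
      by case: n n2 a {f fY finj fsurj fmono Yx Yq Xx Xy yP xy} => [|[|n]] // _ a;
        exists (if a == ord0 then ord_max else ord0); case: (eqVneq a ord0) => [->|].
    have := yP (f (Some b)) (YX _ (Yq _)); rewrite !fmono !treeT_leE.
    by rewrite !orbT !orbF => /(_ isT) /eqP [] /eqP; rewrite (negbTE ab).
  move=> T1; have [k [n [Y [k0 nY XY _ _]]]] := treesX.
  have [n2 [f [[fY finj _] fmono]]] := nY (Ordinal k0).
  have Xf q : X (f q) by rewrite XY; exists (Ordinal k0) => //; exact: fY.
  (* A leaf strictly below its root is a comparable pair, which T1 excludes. *)
  pose a : treeT (n (Ordinal k0)) := Some (Ordinal (ltnW n2)).
  have le_aN : (f a <= f None)%O by rewrite fmono treeT_leE.
  have /finj := accessible_zariski_antichain finX T1 (Xf a) (Xf None) le_aN.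
  by rewrite !inE => /(_ Logic.I Logic.I).
split.
  apply: Kdim_le1 => x y z Xx Xy Xz xy yz.
  (* The middle of a three-element chain is neither maximal nor minimal. *)
  have [ymax|[ymin _]] := T34 y Xy.
    by move: (yz); rewrite (ymax z Xz (ltW yz)) ltxx.
  by move: (xy); rewrite (ymin x Xx (ltW xy)) ltxx.
move=> n n1 [Y [YX [f [[fY finj fsurj] fmono]] Yinc]].
have Xf q : X (f q) by exact/YX/fY.
pose a : treeT n := Some (Ordinal n1).
(* In the dual order [None] is the least element. *)
have le_None q : (f None <= f q)%O by rewrite fmono; apply/orP; right.
have neq : f a = f None -> False by move/finj; rewrite !inE => /(_ Logic.I Logic.I).
have [Nmax|[_ Nint]] := T34 _ (Xf None).
  by apply: neq; exact: Nmax.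
(* Any [z] of [X] below [f a] lies in [Y], as [Y] is isolated, hence above [f None]; the interior
   condition then forces [f a = f None]. *)
apply: neq; apply: Nint => // z Xz za.
have [Yz|nYz] := pselect (Y z).
  by have [q _ <-] := fsurj z Yz.
by have := Yinc _ _ (fY a Logic.I) (conj Xz nYz); rewrite ge_comparable.
Qed.
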